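(* For each integer $k\ge 3$ there is a constant $\gamma_k>0$ such that for all sufficiently large $t$, \[ r_k(4;t) \;\geq\; \gamma_k\,\frac{t^{2k-1}}{(\log t)^{6(k-1)}}, \] i.e. $r_k(4;t)=\Omega\bigl(t^{2k-1}/(\log t)^{6(k-1)}\bigr)$ as $t\to\infty$.
   Context: For $k\ge 2$, $r_k(4;t)$ denotes the minimum $n$ such that every coloring of the edges of the complete graph $K_n$ with $k$ colors contains a monochromatic $K_4$ in one of the first $k-1$ colors or a monochromatic $K_t$ in the last ($k$-th) color. In particular $r_2(4;t)=r(4,t)$. Logarithms are natural. *)

(* Defs.v *)
From mathcomp Require Import all_boot.
From Stdlib Require Import ClassicalEpsilon.
Set Implicit Arguments. Unset Strict Implicit. Unset Printing Implicit Defensive.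

(* A k-colouring of the edges of K_n: the colour of edge {x,y} with x < y is
   c (x, y); values of c on pairs (x,y) with x >= y are irrelevant.
   Colours are 0, ..., k-1; the "last" (k-th) colour is k-1. *)
Definition edge_col (n k : nat) := {ffun 'I_n * 'I_n -> 'I_k}.

Definition has_mono_clique (n k : nat) (c : edge_col n k) (col s : nat) : bool :=
  [exists S : {set 'I_n},
     (#|S| == s) &&
     [forall x in S, forall y in S, (x < y) ==> (val (c (x, y)) == col)]].

Definition ramsey_prop (k t n : nat) : bool :=
  [forall c : edge_col n k,
     [exists i : 'I_k, (i.+1 < k) && has_mono_clique c i 4]
     || has_mono_clique c k.-1 t].

(* r_k(4;t): the minimum n with ramsey_prop k t n (0 if no such n; by
   Ramsey's theorem such n always exists). *)
Definition rk4 (k t : nat) : nat :=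
  match excluded_middle_informative (exists n, ramsey_prop k t n) with
  | left H => ex_minn H
  | right _ => 0
  end.

(* Main.v *)
Require Import Defs.
From mathcomp Require Import all_boot all_algebra all_solvable all_field.
From mathcomp Require Import ring zify.
From Stdlib Require Import ClassicalEpsilon.
Set Implicit Arguments. Unset Strict Implicit. Unset Printing Implicit Defensive.

(* Idea. For q = 2^m take as vertices the q^4 - q^3 secants y = m x + b of the
   affine Hermitian unital y^q + y = x^(q+1) over F_(q^2), put a bit on every
   point-line pair, and join two secants when they meet in a point of the unital
   at which their bits differ. The unital contains no O'Nan configuration (four
   lines meeting in six points of it), so this graph is K_4-free for every choice
   of bits (Mattheus-Verstraete). For some choice every set of 2q^2 secants spans
   of order q^3/log q edges, so by the Kleitman-Winston algorithm the independent
   sets lie in exp(O(q log^3 q)) containers of size O(q^2). Pulling the graph back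
   along k-1 random maps from n points, with t of order q log^3 q and
   n = c t q^(2(k-1)), colours the edges of K_n without K_4 in the first k-1
   colours; a K_t in the last colour has an independent image under every map, and
   a union bound over the t-sets excludes it. *)

(** * The Hermitian unital *)

Section Onan.
Import GRing.Theory.
Local Open Scope ring_scope.
Variables (F : fieldType) (c : F -> F).
Hypothesis cB : {morph c : x y / x - y}.
Hypothesis cM : {morph c : x y / x * y}.

(** With [c] the conjugation x -> x^q, [h u u = 0] puts the point [u] on the unital; [f l u = 0]
    puts it on the line of slope [l.1] and intercept [l.2]. *)
Let h (u v : F * F) := u.2 + c v.2 - u.1 * c v.1.
Let f (l u : F * F) := u.2 - l.1 * u.1 - l.2.

Lemma lines_meet (u u' l l' : F * F) :
  f l u = 0 -> f l' u = 0 -> f l u' = 0 -> f l' u' = 0 -> u = u' \/ l = l'.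
Proof.
case: u u' l l' => [x y] [x' y'] [m b] [m' b']; rewrite /f /= => e1 e2 e3 e4.
have : (m - m') * (x - x') = 0.
  transitivity ((y - m' * x - b') - (y - m * x - b) -
    ((y' - m' * x' - b') - (y' - m * x' - b))); first by ring.
  by rewrite e1 e2 e3 e4 !subr0.
move/eqP; rewrite mulf_eq0 !subr_eq0 => /orP [] /eqP e5.
  by right; move: e1; rewrite -e2 e5 => /addrI /oppr_inj ->.
by left; move: e1; rewrite -e3 e5 => /addIr /addIr ->.
Qed.

(* [f l' v *: u - f l' u *: v] is proportional to the vector of the point [w] where
   the lines [l] and [l'] meet, hence isotropic. *)
Lemma hermitian_meet (l l' u v w : F * F) :
  h u u = 0 -> h v v = 0 -> h w w = 0 ->
  f l u = 0 -> f l v = 0 -> f l w = 0 -> f l' w = 0 ->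
  f l' v * c (f l' u) * h u v + f l' u * c (f l' v) * h v u = 0.
Proof.
case: l l' u v w => [m b] [n d] [x1 y1] [x2 y2] [x3 y3]; rewrite /h /f /=.
move=> h1 h2 h3 e1 e2 e3 e4.
have E1 : y1 = m * x1 + b by apply/eqP; rewrite -subr_eq0 opprD addrA e1.
have E2 : y2 = m * x2 + b by apply/eqP; rewrite -subr_eq0 opprD addrA e2.
have E3 : y3 = m * x3 + b by apply/eqP; rewrite -subr_eq0 opprD addrA e3.
have E4 : y3 = n * x3 + d by apply/eqP; rewrite -subr_eq0 opprD addrA e4.
have Eb : b = d - (m - n) * x3.
  by transitivity (y3 - m * x3); [rewrite E3|rewrite E4]; ring.
have -> : y1 - n * x1 - d = (m - n) * (x1 - x3) by rewrite E1 Eb; ring.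
have -> : y2 - n * x2 - d = (m - n) * (x2 - x3) by rewrite E2 Eb; ring.
have C1 : c y1 = c y3 - c m * (c x3 - c x1).
  by rewrite -cB -cM -cB E1 E3; congr (c _); ring.
have C2 : c y2 = c y3 - c m * (c x3 - c x2).
  by rewrite -cB -cM -cB E2 E3; congr (c _); ring.
rewrite !(cB, cM) C1 C2.
move: h1 h2 h3; rewrite C1 C2 => h1 h2 h3.
have e5 : y1 = y3 - m * (x3 - x1) by rewrite E1 E3; ring.
have e6 : y2 = y3 - m * (x3 - x2) by rewrite E2 E3; ring.
rewrite e5 in h1 *; rewrite e6 in h2 *.
set R := (X in X = 0).
have -> : R = (m - n) * (c m - c n) * (
   (x2 - x3) * (c x2 - c x3) * (y3 - m * (x3 - x1) + (c y3 - c m * (c x3 - c x1)) - x1 * c x1)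
 + (x1 - x3) * (c x1 - c x3) * (y3 - m * (x3 - x2) + (c y3 - c m * (c x3 - c x2)) - x2 * c x2)
 - (x2 - x1) * (c x2 - c x1) * (y3 + c y3 - x3 * c x3)).
  by rewrite /R; ring.
by rewrite h1 h2 h3; ring.
Qed.

(* The left side is the Gram determinant of the vectors [(u, 1)], [(v, 1)], [(w, 1)]. *)
Lemma gram_isotropic (u v w : F * F) :
  h u u = 0 -> h v v = 0 -> h w w = 0 ->
  h u v * h v w * h w u + h v u * h w v * h u w =
  (u.1 * (v.2 - w.2) - v.1 * (u.2 - w.2) + w.1 * (u.2 - v.2)) *
  (c u.1 * (c v.2 - c w.2) - c v.1 * (c u.2 - c w.2) + c w.1 * (c u.2 - c v.2)).
Proof.
case: u v w => [x1 y1] [x2 y2] [x3 y3]; rewrite /h /= => h1 h2 h3.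
have -> : c y1 = x1 * c x1 - y1 by apply/eqP; rewrite -subr_eq0 -h1; apply/eqP; ring.
have -> : c y2 = x2 * c x2 - y2 by apply/eqP; rewrite -subr_eq0 -h2; apply/eqP; ring.
have -> : c y3 = x3 * c x3 - y3 by apply/eqP; rewrite -subr_eq0 -h3; apply/eqP; ring.
ring.
Qed.

Hypothesis c_eq0 : forall x, c x = 0 -> x = 0.

Lemma onan_free (l1 l2 l3 l4 a b d a' b' d' : F * F) :
  h a a = 0 -> h b b = 0 -> h d d = 0 ->
  h a' a' = 0 -> h b' b' = 0 -> h d' d' = 0 ->
  f l1 a = 0 -> f l1 b = 0 -> f l1 d' = 0 -> f l4 d' = 0 ->
  f l2 a = 0 -> f l2 d = 0 -> f l2 b' = 0 -> f l4 b' = 0 ->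
  f l3 b = 0 -> f l3 d = 0 -> f l3 a' = 0 -> f l4 a' = 0 ->
  a <> b -> f l1 d <> 0 -> f l4 a <> 0 -> f l4 b <> 0 -> f l4 d <> 0 -> False.
Proof.
move=> ha hb hd ha' hb' hd' a1 b1 d'1 d'4 a2 d2 b'2 b'4 b3 d3 a'3 a'4.
move=> /eqP nab /eqP d1 /eqP a4 /eqP b4 /eqP d4.
have := hermitian_meet ha hb hd' a1 b1 d'1 d'4.
have := hermitian_meet hb hd ha' b3 d3 a'3 a'4.
have := hermitian_meet hd ha hb' d2 a2 b'2 b'4.
have G := gram_isotropic ha hb hd.
move: G; set hab := h a b; set hba := h b a; set hbd := h b d; set hdb := h d b.
set had := h a d; set hda := h d a; move=> G E3 E2 E1.
have nc x : x != 0 -> c x != 0 by apply: contraNneq => /c_eq0 ->.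
pose n := f l4 a * f l4 b * f l4 d * c (f l4 a) * c (f l4 b) * c (f l4 d).
have n0 : n != 0 by rewrite /n !mulf_neq0 ?nc.
(* After rescaling, the three entries of the Gram matrix above the diagonal are
   opposite to their conjugates, so the two triple products cancel and [a], [b], [d]
   would be collinear. *)
have : n * (hab * hbd * hda + hba * hdb * had) = 0.
  have F1 := canRL (addrK _) E1; have F2 := canRL (addrK _) E2.
  have F3 := canRL (addrK _) E3.
  transitivity ((f l4 b * c (f l4 a) * hab) * (f l4 d * c (f l4 b) * hbd) *
     (f l4 a * c (f l4 d) * hda) + n * (hba * hdb * had)).
    by rewrite /n; ring.
  by rewrite F1 F2 F3 /n; ring.
move/eqP; rewrite mulf_eq0 (negPf n0) /= G.
set D := (X in X * _ == _); set D' := (X in _ * X == _).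
have cD x y : c (x + y) = c x + c y by rewrite -[in RHS](addrK y x) cB subrK.
have -> : D' = c D by rewrite /D /D' !(cB, cD, cM).
have D0 : D != 0.
  have eqf l u : f l u = 0 -> u.2 = l.1 * u.1 + l.2.
    by move=> e; apply/eqP; rewrite -subr_eq0 opprD addrA -e.
  (* Both factors are nonzero: [d] is off [l1], and two points of [l1] with equal abscissa
     coincide. *)
  have -> : D = (b.1 - a.1) * f l1 d by rewrite /D (eqf _ _ a1) (eqf _ _ b1) /f; ring.
  rewrite mulf_neq0 // subr_eq0; apply: contraNneq nab => e.
  apply/eqP; rewrite [LHS]surjective_pairing [RHS]surjective_pairing.
  by rewrite (eqf _ _ a1) (eqf _ _ b1) e.
by rewrite mulf_eq0 (negPf D0) (negPf (nc _ D0)).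
Qed.
End Onan.

(** * Counting points, tangents and secants over F_(q^2) *)

Section Unital.
Import GRing.Theory.
Local Open Scope ring_scope.
Variables (F : finFieldType) (q : nat).
Hypotheses (q_gt1 : (1 < q)%N) (cardF : #|F| = (q ^ 2)%N).
Hypothesis cD : forall x y : F, (x + y) ^+ q = x ^+ q + y ^+ q.

Lemma conj_sub : {morph (fun x : F => x ^+ q) : x y / x - y}.
Proof. by move=> x y /=; apply: (canRL (addrK _)); rewrite -cD subrK. Qed.

Lemma conjK (x : F) : (x ^+ q) ^+ q = x.
Proof. by rewrite -exprM mulnn -cardF expf_card. Qed.

Lemma card_trace_fiber (e : F) : (#|[set y : F | (y + y ^+ q == e)%R]| <= q)%N.
Proof.
pose p : {poly F} := 'X^q + ('X - e%:P).
have sp : size p = q.+1 by rewrite /p size_polyDl size_polyXn // size_XsubC.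
have p0 : p != 0 by rewrite -size_poly_eq0 sp.
rewrite -ltnS -sp cardE; apply: max_poly_roots p0 _ (enum_uniq _).
apply/allP=> y; rewrite mem_enum inE => /eqP ey.
rewrite rootE /p hornerD hornerXn hornerXsubC -ey; apply/eqP; ring.
Qed.

(** The group of units is cyclic of order (q - 1)(q + 1). Since e^(q-1) = 1, [e] is g^(j(q+1)) for a
    generator [g], and the elements g^(j+(q-1)k) with k <= q have norm [e]. *)
Lemma norm_fiber (e : F) : e != 0 -> e ^+ q = e ->
  exists z : 'I_q.+1 -> F, injective z /\ forall i, z i * z i ^+ q = e.
Proof.
move=> e0 ce.
have q0 : (0 < q)%N by apply: ltnW.
pose n := (q ^ 2).-1.
have nE : n = (q.-1 * q.+1)%N by rewrite /n; nia.
have n0 : (0 < n)%N by rewrite nE muln_gt0 -ltnS prednK // q_gt1.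
have : has n.-primitive_root (enum (predC1 (0 : F))).
  apply: has_prim_root; rewrite ?enum_uniq -?cardE ?cardC1 ?cardF //.
  apply/allP=> x; rewrite mem_enum !inE => x0.
  apply/unity_rootP; apply: (mulfI x0).
  by rewrite mulr1 -exprS /n prednK ?expn_gt0 ?q0 // -cardF expf_card.
case/hasP=> g _ gP.
have en : e ^+ n = 1.
  rewrite nE exprM; suff -> : e ^+ q.-1 = 1 by rewrite expr1n.
  by apply: (mulfI e0); rewrite mulr1 -exprS prednK.
have [i ei] : exists i : nat, e = g ^+ i by case: (prim_rootP gP en) => i ->; exists i.
have : (n %| i * q.-1)%N.
  rewrite (prim_order_dvd gP) exprM -ei; apply/eqP.
  by apply: (mulfI e0); rewrite mulr1 -exprS prednK.
rewrite nE mulnC dvdn_pmul2r; last by rewrite -ltnS prednK.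
case/dvdnP=> j ij.
exists (fun k : 'I_q.+1 => g ^+ (j + q.-1 * k)); split.
  move=> k k' /eqP; rewrite (eq_prim_root_expr gP) eqn_modDl nE.
  rewrite -!muln_modr eqn_pmul2l; last by rewrite -ltnS prednK.
  by rewrite !modn_small // => /eqP /val_inj.
move=> k; rewrite -exprS -exprM ei ij mulnDl exprD.
suff -> : g ^+ (q.-1 * k * q.+1) = 1 by rewrite mulr1.
by rewrite mulnAC -nE exprM (prim_expr_order gP) expr1n.
Qed.

Let h (u v : F * F) := u.2 + v.2 ^+ q - u.1 * v.1 ^+ q.

Lemma card_isotropic : (#|[set u : F * F | (h u u == 0)%R]| <= q ^ 3)%N.
Proof.
rewrite -sum1dep_card -(pair_big_dep xpredT (fun x y => h (x, y) (x, y) == 0) (fun _ _ => 1%N)) /=.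
rewrite expnSr -cardF -sum_nat_const; apply: leq_sum => x _.
rewrite sum1dep_card; apply: leq_trans (card_trace_fiber (x * x ^+ q)).
by apply: subset_leq_card; apply/subsetP=> y; rewrite !inE /h /= subr_eq0.
Qed.

(** These lines are the tangents; for each slope the intercepts form a fibre of the trace y +
    y^q. *)
Lemma card_tangent : (#|[set l : F * F | (l.2 + l.2 ^+ q + l.1 * l.1 ^+ q == 0)%R]| <= q ^ 3)%N.
Proof.
rewrite -sum1dep_card -(pair_big_dep xpredT (fun m b => (b + b ^+ q) + m * m ^+ q == 0) (fun _ _ => 1%N)) /=.
rewrite expnSr -cardF -sum_nat_const; apply: leq_sum => x _.
rewrite sum1dep_card; apply: leq_trans (card_trace_fiber (- (x * x ^+ q))).
by apply: subset_leq_card; apply/subsetP=> y; rewrite !inE addr_eq0.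
Qed.

(** Substituting x = z + m^q in the equation of the unital along y = m x + b leaves the norm
    equation z^(q+1) = b + b^q + m^(q+1). *)
Lemma secant_points (l : F * F) : (l.2 + l.2 ^+ q) + l.1 * l.1 ^+ q != 0 ->
  exists u : 'I_q.+1 -> F * F, injective u /\
    forall i, h (u i) (u i) = 0 /\ (u i).2 - l.1 * (u i).1 - l.2 = 0.
Proof.
case: l => m b /= /norm_fiber.
case; first by rewrite !cD exprMn !conjK; ring.
move=> z [zi zE].
exists (fun i => let x := z i + m ^+ q in (x, m * x + b)); split.
  by move=> i j /= [] /addIr /zi.
move=> i; split; last by rewrite /=; ring.
rewrite /h /= !(cD, exprMn) conjK.
transitivity ((b + b ^+ q + m * m ^+ q) - z i * z i ^+ q); last by rewrite zE subrr.
ring.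
Qed.
End Unital.

(* [ul_onan] is stated for the triangle a b d on l1, l2, l3 cut by l4 in a', b', d'. *)
Record unital_like (m : nat) (P V : finType) (inc : P -> V -> bool) : Prop := UnitalLike {
  ul_points : #|P| <= 2 ^ (3 * m);
  ul_lines_ge : 2 ^ (4 * m - 1) <= #|V|;
  ul_lines_le : #|V| <= 2 ^ (4 * m);
  ul_line : forall l, 2 ^ m < #|[set p | inc p l]|;
  ul_meet : forall p p' l l', inc p l -> inc p l' -> inc p' l -> inc p' l' ->
    p = p' \/ l = l';
  ul_onan : forall l1 l2 l3 l4 a b d a' b' d',
    inc a l1 -> inc b l1 -> inc d' l1 -> inc d' l4 ->
    inc a l2 -> inc d l2 -> inc b' l2 -> inc b' l4 ->
    inc b l3 -> inc d l3 -> inc a' l3 -> inc a' l4 ->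
    a <> b -> ~~ inc d l1 -> ~~ inc a l4 -> ~~ inc b l4 -> ~~ inc d l4 -> False }.

Section Existence.
Import GRing.Theory.

Lemma unital_exists (m : nat) : 0 < m -> exists (P V : finType) (inc : P -> V -> bool),
  unital_like m inc.
Proof.
move=> m0; have [|F F2 cardF'] := @pPrimePowerField 2 (m.*2) isT; first by rewrite double_gt0.
pose q := 2 ^ m.
have q1 : 1 < q by rewrite -{1}(expn0 2) ltn_exp2l.
have cardF : #|F| = q ^ 2 by rewrite cardF' -expnM muln2.
have cD (x y : F) : ((x + y) ^+ q = x ^+ q + y ^+ q)%R.
  by apply: exprDn_pchar; rewrite pnatX; apply/orP; left; rewrite pnatE.
pose c (x : F) := (x ^+ q)%R.
have c0 x : c x = 0%R -> x = 0%R by move/eqP; rewrite expf_eq0 => /andP [_ /eqP].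
pose P := {u : F * F | (u.2 + u.2 ^+ q - u.1 * u.1 ^+ q == 0)%R}.
pose V := {l : F * F | (l.2 + l.2 ^+ q + l.1 * l.1 ^+ q != 0)%R}.
pose inc (p : P) (l : V) := ((val p).2 - (val l).1 * (val p).1 - (val l).2 == 0)%R.
have incE p l : inc p l -> ((val p).2 - (val l).1 * (val p).1 - (val l).2 = 0)%R by move/eqP.
exists P, V, inc; split.
- by rewrite card_sig mulnC expnM -cardsE card_isotropic.
(* At most q^3 of the q^4 lines are tangents, which leaves at least q^4 - q^3 >= q^4/2 because q >=
   2. *)
- rewrite card_sig.
  have T := card_tangent q1 cardF.
  have := cardsC [set l : F * F | (l.2 + l.2 ^+ q + l.1 * l.1 ^+ q == 0)%R].
  rewrite card_prod cardF.
  rewrite (_ : ~: _ = [set l : F * F | (l.2 + l.2 ^+ q + l.1 * l.1 ^+ q != 0)%R]); last by apply/setP=> l; rewrite !inE.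
  rewrite [X in _ + X = _]cardsE => E.
  have -> : 2 ^ (4 * m - 1) = q ^ 3 * 2 ^ (m - 1).
    by rewrite /q -expnM -expnD; congr (_ ^ _); lia.
  have Q : q = 2 * 2 ^ (m - 1) by rewrite -expnS /q; congr (_ ^ _); lia.
  by move: T E; rewrite Q; set r := 2 ^ _; set A := #|_|; set B := #|_|; nia.
- by rewrite card_sig (leq_trans (max_card _)) // card_prod cardF -expnD mulnC expnM.
- move=> l; have [u [ui uE]] := secant_points q1 cardF cD (valP l).
  have Hu i : ((u i).2 + (u i).2 ^+ q - (u i).1 * (u i).1 ^+ q == 0)%R by rewrite (uE i).1.
  pose w i : P := exist _ (u i) (Hu i).
  have wi : injective w by move=> i j [] /ui.
  rewrite -[q.+1]card_ord -(card_imset _ wi); apply: subset_leq_card.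
  by apply/subsetP=> _ /imsetP [i _ ->]; rewrite inE /inc /= (uE i).2.
- move=> p p' l l' /incE e1 /incE e2 /incE e3 /incE e4.
  by have [/val_inj|/val_inj] := lines_meet e1 e2 e3 e4; [left|right].
- move=> l1 l2 l3 l4 a b d a' b' d' a1 b1 d'1 d'4 a2 d2 b'2 b'4 b3 d3 a'3 a'4.
  move=> nab /eqP d1 /eqP a4 /eqP b4 /eqP d4.
  have hP (p : P) : ((val p).2 + c (val p).2 - (val p).1 * c (val p).1 = 0)%R by apply/eqP/(valP p).
  apply: (@onan_free F c (conj_sub cD) _ c0 (val l1) (val l2) (val l3) (val l4)
     (val a) (val b) (val d) (val a') (val b') (val d')); rewrite ?hP //; try exact: incE.
  + by move=> x y; rewrite /c exprMn.
  + by move/val_inj.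
Qed.
End Existence.

(** * Random bits *)

(** A set of at most [k] elements is listed by a [k]-tuple padded with [None]. *)
Lemma card_small_sets (T : finType) k :
  #|[set S : {set T} | #|S| <= k]| <= #|T|.+1 ^ k.
Proof.
pose im (f : {ffun 'I_k -> option T}) := [set x | Some x \in codom f].
have <- : #|{ffun 'I_k -> option T}| = #|T|.+1 ^ k by rewrite card_ffun card_option card_ord.
apply: leq_trans (leq_imset_card im _); apply: subset_leq_card.
apply/subsetP=> S; rewrite inE => Sk; apply/imsetP.
exists [ffun i : 'I_k => onth (enum S) i] => //.
apply/setP=> x; rewrite inE; apply/idP/idP => [xS|].
  have ix : index x (enum S) < k by rewrite (leq_trans _ Sk) // cardE index_mem mem_enum.
  apply/codomP; exists (Ordinal ix); rewrite ffunE /=.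
  by rewrite onthE (nth_map x) ?nth_index ?index_mem ?mem_enum.
case/codomP=> i; rewrite ffunE => e.
by rewrite -mem_enum; apply/onthP; exists i.
Qed.

Lemma card_bigcup_le (I T : finType) (A : {pred I}) (B : I -> {set T}) :
  #|\bigcup_(i in A) B i| <= \sum_(i in A) #|B i|.
Proof.
elim/big_rec2: _ => [|i n C _ le]; first by rewrite cards0.
by rewrite (leq_trans (leq_card_setU _ _)) // leq_add2l.
Qed.

(** Independence of the values of a uniformly random function, stated without division. *)
Lemma card_restricted_ffun (T R : finType) (Z : {set T}) (B : T -> {set R}) :
  #|[set f : {ffun T -> R} | [forall z in Z, f z \in B z]]| * #|R| ^ #|Z| =
  (\prod_(z in Z) #|B z|) * #|R| ^ #|T|.
Proof.
have -> : [set f : {ffun T -> R} | [forall z in Z, f z \in B z]] =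
   [set f | f \in family (fun z => [pred x | (z \in Z) ==> (x \in B z)])].
  by apply/setP=> f; rewrite in_set.
rewrite cardsE card_family foldrE big_map big_enum /=.
rewrite -!prod_nat_const 2!(big_mkcond (mem Z)) /= -!big_split /=.
apply: eq_bigr => z _.
case: ifP => _; rewrite ?mul1n ?muln1 //; congr (_ * _); exact: eq_card.
Qed.

Section Bicoloured.
Variables (P V : finType) (inc : P -> V -> bool).
Hypothesis meet : forall p p' l l', inc p l -> inc p l' -> inc p' l -> inc p' l' ->
    p = p' \/ l = l'.

Definition cuts (chi : {ffun P * V -> bool}) p l l' :=
  [&& inc p l, inc p l' & chi (p, l) != chi (p, l')].

Definition bicol_adj (chi : {ffun P * V -> bool}) (l l' : V) := [exists p, cuts chi p l l'].

(* Ordered pairs: every edge is counted twice. *)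
Definition edges (r : rel V) (A : {set V}) := [set z : V * V | [&& z.1 \in A, z.2 \in A & r z.1 z.2]].

Lemma cutsC chi p l l' : cuts chi p l l' = cuts chi p l' l.
Proof. by rewrite /cuts andbCA eq_sym. Qed.

Lemma bicol_adjC chi : symmetric (bicol_adj chi).
Proof. by move=> l l'; apply: eq_existsb => p; apply: cutsC. Qed.

Lemma cuts_neq chi p l l' : cuts chi p l l' -> l <> l'.
Proof. by case/and3P=> _ _ + e; rewrite e eqxx. Qed.

(** If two of the meeting points agreed, all three lines would pass through one point with pairwise
    different bits, but there are only two bits. *)
Lemma cuts_triangle chi p12 p13 p23 l1 l2 l3 :
  cuts chi p12 l1 l2 -> cuts chi p13 l1 l3 -> cuts chi p23 l2 l3 -> p12 <> p13.
Proof.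
move=> c12 + c23 e; rewrite -e => c13.
have n23 := cuts_neq c23.
case/and3P: c12 => i1 i2 d12; case/and3P: c13 => _ i3 d13; case/and3P: c23 => j2 j3 d23.
have [e'|//] := meet i2 i3 j2 j3; move: d12 d13 d23; rewrite -e'.
by case: (chi _); case: (chi _); case: (chi _).
Qed.

(* On the flags of [A], such a [chi] is constant along each point up to the exceptional
   flags [S]: this is what few edges inside [A] force. *)
Definition determined (A : {set V}) (M : {set P}) (S : {set P * V}) :=
  [set chi : {ffun P * V -> bool} | [forall z in [set z | (z.2 \in A) && inc z.1 z.2],
     chi z == (z.1 \in M) && (z \notin S)]].

Lemma determined_few_edges chi A : exists (M : {set P}) (S : {set P * V}),
  #|S| <= #|edges (bicol_adj chi) A| /\ chi \in determined A M S.
Proof.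
(* [M] holds the points with bit 1 on some line of [A], and [S] the flags of [A] with bit 0 at such
   a point. *)
pose M := [set p | [exists l in A, inc p l && chi (p, l)]].
pose S := [set z : P * V | [&& z.2 \in A, inc z.1 z.2, ~~ chi z & z.1 \in M]].
exists M, S; split; last first.
  rewrite inE; apply/forall_inP=> -[p l]; rewrite !inE /= => /andP [lA ipl].
  rewrite lA ipl /=; case: existsP => [_|h]; rewrite ?andbT ?negbK //.
  by case E : (chi _) => //; case: h; exists l; rewrite lA ipl E.
(* Each flag of [S] yields an edge, from its line to a line of [A] with bit 1 at the same point. The
   edge determines the flag, as two lines meet at most once; the default [z.2] never occurs on
   [S]. *)
pose g (z : P * V) := (z.2, odflt z.2 [pick l in A | inc z.1 l && chi (z.1, l)]).
have gP z : z \in S -> [/\ z.2 \in A, (g z).2 \in A & cuts chi z.1 z.2 (g z).2].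
  case: z => p l; rewrite !inE /g /= => /and4P [lA ipl cpl /existsP [l0 h0]].
  case: pickP => [l' /and3P [l'A i' c']|/(_ l0)]; last by rewrite h0.
  by split=> //=; apply/and3P; split; rewrite // c' (negPf cpl).
rewrite -(@card_in_imset _ _ g); last first.
  move=> [p l] [p' l'] /gP [_ _ c1] /gP [_ _ c2] e.
  have el : l = l' := congr1 fst e; rewrite e /= el in c1 *; congr (_, _).
  have ne := cuts_neq c2.
  case/and3P: c1 => a1 a2 _; case/and3P: c2 => b1 b2 _.
  by have [] := meet a1 a2 b1 b2.
apply: subset_leq_card; apply/subsetP=> _ /imsetP [z /gP [zA gA c] ->].
by rewrite inE zA gA; apply/existsP; exists z.1.
Qed.

(** The bits are prescribed on all flags of [A], of which there are at least [s * #|A|]. *)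
Lemma card_determined s A M S : (forall l, s <= #|[set p | inc p l]|) ->
  #|determined A M S| * 2 ^ (s * #|A|) <= 2 ^ (#|P| * #|V|).
Proof.
move=> hs; set Z := [set z : P * V | (z.2 \in A) && inc z.1 z.2].
have := card_restricted_ffun Z (fun z => [set (z.1 \in M) && (z \notin S)]).
rewrite card_bool card_prod big1 ?mul1n => [<-|z _]; last by rewrite cards1.
rewrite leq_mul ?leq_exp2l //.
  apply: subset_leq_card; apply/subsetP=> chi; rewrite !inE => /forall_inP h.
  by apply/forall_inP => z zZ; rewrite inE; apply: h.
rewrite mulnC -sum_nat_const.
rewrite -sum1dep_card (reindex (fun z : V * P => (z.2, z.1))) /=; last first.
  by exists (fun z : P * V => (z.2, z.1)) => -[].
rewrite -(pair_big_dep (mem A) (fun l p => inc p l) (fun _ _ => 1)) /=.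
by apply: leq_sum => l _; rewrite sum1dep_card.
Qed.

(** Union bound over the triples [(A, M, S)]; the three factors on the left bound the numbers of
    choices of [A], [M] and [S]. *)
Lemma few_edges_avoidable s a E0 : (forall l, s <= #|[set p | inc p l]|) ->
  #|V|.+1 ^ a * 2 ^ #|P| * (#|P| * #|V|).+1 ^ E0 < 2 ^ (s * a) ->
  exists chi, forall A : {set V}, #|A| = a -> E0 < #|edges (bicol_adj chi) A|.
Proof.
move=> hs hlt.
pose bad := [set chi | [exists A : {set V}, (#|A| == a) && (#|edges (bicol_adj chi) A| <= E0)]].
have [/eqP badT|nb] := boolP (bad == setT); last first.
  have [chi] : exists chi, chi \notin bad.
    apply/existsP; apply: contraNT nb; rewrite negb_exists => /forallP h.
    by apply/eqP/setP=> chi; rewrite in_setT; apply/negPn/h.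
  rewrite inE negb_exists => /forallP h; exists chi => A /eqP Aa.
  by have := h A; rewrite Aa /= -ltnNge.
pose I := setX (setX [set A : {set V} | #|A| == a] [set: {set P}]) [set S : {set P * V} | #|S| <= E0].
have sub : bad \subset \bigcup_(i in I) determined i.1.1 i.1.2 i.2.
  apply/subsetP=> chi; rewrite inE => /existsP [A /andP [Aa Ae]].
  have [M [S [Sle dS]]] := determined_few_edges chi A.
  by apply/bigcupP; exists (A, M, S); rewrite // !inE Aa (leq_trans Sle).
have : #|bad| * 2 ^ (s * a) <= #|I| * 2 ^ (#|P| * #|V|).
  apply: leq_trans (_ : (\sum_(i in I) #|determined i.1.1 i.1.2 i.2|) * 2 ^ (s * a) <= _).
    rewrite leq_mul2r; apply/orP; right.
    exact: leq_trans (subset_leq_card sub) (card_bigcup_le _ _).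
  rewrite big_distrl /= -[leqRHS]sum_nat_const; apply: leq_sum => -[[A M] S] /=.
  rewrite !inE => /andP [/andP [/eqP <- _] _]; exact: card_determined.
rewrite badT cardsT card_ffun card_bool card_prod mulnC leq_mul2r expn_eq0 /= => le.
suff : 2 ^ (s * a) < 2 ^ (s * a) by rewrite ltnn.
apply: leq_ltn_trans le (leq_ltn_trans _ hlt).
rewrite !cardsX -powersetT card_powerset cardsT -card_prod !leq_mul //; last exact: card_small_sets.
apply: leq_trans (card_small_sets V a); apply: subset_leq_card.
by apply/subsetP=> A; rewrite !inE => /eqP ->.
Qed.
End Bicoloured.

(** * Supersaturation and containers *)

Section Supersaturation.
Variables (V : finType) (r : rel V).
Hypothesis r_irr : irreflexive r.

(** An edge inside [A] survives the deletion of every vertex but its two ends, distinct by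
    irreflexivity. *)
Lemma sum_edges_del (A : {set V}) :
  \sum_(v in A) #|edges r (A :\ v)| = (#|A| - 2) * #|edges r A|.
Proof.
under eq_bigr => v vA.
  rewrite (_ : edges r (A :\ v) = [set z in edges r A | (z.1 != v) && (z.2 != v)]); last first.
    by apply/setP=> z; rewrite !inE; do 2 case: (_ == v); rewrite ?andbF ?andbT.
  rewrite -sum1dep_card; over.
rewrite mulnC -sum_nat_const /=.
rewrite (exchange_big_dep (mem (edges r A))) /=; last by move=> v z _ /andP [].
apply: eq_bigr => -[x y]; rewrite inE /= => /and3P [xA yA rxy].
have nxy : x != y by apply: contraTneq rxy => ->; rewrite r_irr.
have {}xA : x \in A by []. have {}yA : y \in A by [].
have -> : #|A| - 2 = #|A :\ x :\ y|.
  by rewrite (cardsD1 x A) xA (cardsD1 y (A :\ x)) !inE yA eq_sym nxy add1n add1n subn2.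
rewrite sum1dep_card; apply: eq_card => v.
by rewrite !inE xA yA rxy /= (eq_sym x) (eq_sym y); case: (v == x); case: (v == y); rewrite ?andbF ?andbT.
Qed.

(* Deleting a vertex of [A] on average keeps a proportion [1 - 2/#|A|] of the edges, so
   a bound for all [a]-sets passes to larger sets. *)
Lemma edges_upscale a E : 2 <= a ->
  (forall A : {set V}, #|A| = a -> E <= #|edges r A|) ->
  forall A : {set V}, a <= #|A| -> E * (#|A| * #|A|.-1) <= #|edges r A| * (a * a.-1).
Proof.
move=> a2 hE A; have [n An] := ubnP #|A|; elim: n A An => [|n IH] // A.
rewrite ltnS leq_eqVlt => /orP [/eqP An|lt]; last exact: IH.
rewrite leq_eqVlt => /orP [/eqP e|lt]; first by rewrite -e leq_mul2r hE ?orbT.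
rewrite An in lt *; case: n IH An lt => [|n] IH An lt; first by lia.
have n2 : 0 < n.-1 by lia.
rewrite -(leq_pmul2l n2) /=.
have -> : n.-1 * (#|edges r A| * (a * a.-1)) = (\sum_(v in A) #|edges r (A :\ v)|) * (a * a.-1).
  by rewrite sum_edges_del An subSS subn1 mulnA.
apply: leq_trans (_ : \sum_(v in A) E * (n * n.-1) <= _).
  by rewrite sum_nat_const An; nia.
rewrite big_distrl /=; apply: leq_sum => v vA.
have cAv : #|A :\ v| = n by move: An; rewrite (cardsD1 v A) vA => -[].
by rewrite -cAv; apply: IH; rewrite cAv.
Qed.

(** If all degrees in [A] were below [#|A| / D], then [A] would span fewer than [#|A|^2 / D] edges,
    against the density E/a^2 >= 1/D inherited from the [a]-sets. *)
Lemma max_degree a E D : 2 <= a -> 0 < E -> a ^ 2 <= E * D ->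
  (forall A : {set V}, #|A| = a -> E <= #|edges r A|) ->
  forall A : {set V}, a <= #|A| ->
  exists2 v, v \in A & #|A| <= D * #|[set y in A | r v y]|.
Proof.
move=> a2 E0 aED hE A aA.
have U := edges_upscale a2 hE aA.
case: (boolP [exists v in A, #|A| <= D * #|[set y in A | r v y]|]) => [/existsP [v /andP [vA ?]]|].
  by exists v.
rewrite negb_exists_in => /forall_inP h.
have eE : #|edges r A| = \sum_(v in A) #|[set y in A | r v y]|.
  rewrite -sum1dep_card (eq_bigl (fun z : V * V => (z.1 \in A) && ((z.2 \in A) && r z.1 z.2))) //.
  rewrite -(pair_big_dep (mem A) (fun x y => (y \in A) && r x y) (fun _ _ => 1)) /=.
  by apply: eq_bigr => v _; rewrite sum1dep_card.
have : D * #|edges r A| < #|A| * #|A|.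
  rewrite eE big_distrr /= -sum_nat_const.
  have [v vA] : exists v, v \in A by apply/card_gt0P; lia.
  rewrite (bigD1 v) // [X in _ < X](bigD1 v) //= -addSn leq_add //.
    by rewrite ltnNge h.
  by apply: leq_sum => w /andP [wA _]; apply/ltnW; rewrite ltnNge h.
move: U aED aA; set n := #|A|; set e := #|edges r A| => U aED an lt.
have n1 : 0 < n by lia.
(* As a <= n, the ratio (a - 1)/(n - 1) is at most a/n; this replaces a(a - 1) and n(n - 1) by
   squares. *)
have B : n * (a * a.-1) <= n.-1 * (a * a) by nia.
have C1 : E * n * (n * (a * a.-1)) <= e * (a * a.-1) * (a * a).
  by apply: leq_trans (_ : E * n * (n.-1 * (a * a)) <= _); [rewrite leq_mul2l B orbT | nia].
have pa : 0 < a * a.-1 by nia.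
have C2 : E * (n * n) <= e * (a * a) by rewrite -(leq_pmul2r pa); move: C1; nia.
have : E * (n * n) <= e * (E * D) by apply: leq_trans C2 _; rewrite leq_mul2l mulnn aED orbT.
nia.
Qed.
End Supersaturation.

Section Containers.
Variables (V : finType) (r : rel V) (a D : nat).
Hypothesis D_gt0 : 0 < D.
Hypothesis deg : forall A : {set V}, a <= #|A| ->
  exists2 v, v \in A & #|A| <= D * #|[set y in A | r v y]|.

Definition independent (I : {set V}) := [forall x in I, forall y in I, ~~ r x y].

Definition container_family (A : {set V}) (b : nat) (cs : seq {set V}) :=
  (forall C, C \in cs -> #|C| <= b) /\
  forall I : {set V}, independent I -> I \subset A -> exists2 C, C \in cs & I \subset C.

(* Kleitman-Winston: a vertex [v] of large degree either is absent from [I], or leaves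
   only a proportion [1 - 1/D] of [A] for the rest of [I]. *)
Lemma containers_in L (A : {set V}) : #|A| * D.-1 ^ L <= a * D ^ L ->
  exists cs, container_family A (a + L) cs /\ size cs <= #|V|.+1 ^ L.
Proof.
have single (B : {set V}) b : #|B| <= b -> container_family B b [:: B].
  split=> [C|I _ IB]; first by rewrite inE => /eqP ->.
  by exists B; rewrite ?inE.
elim: L A => [|L IHL] A; first by rewrite !muln1 => Aa; exists [:: A]; rewrite addn0; split; [apply: single|].
move=> hA.
suff [cs [csA szcs]] : exists cs, container_family A (a + L.+1) cs /\ size cs <= 1 + #|A| * #|V|.+1 ^ L.
  exists cs; split=> //; apply: leq_trans szcs _; rewrite expnS mulSn leq_add ?expn_gt0 //.
  by rewrite leq_mul2r max_card orbT.
(* The outer induction counts vertices taken into [I], the inner one vertices discarded. Each inner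
   step adds the containers of the sets that take [v], at most [#|V|.+1 ^ L] of them. *)
move: {-1}#|A| (leqnn #|A|) => n; elim: n A hA => [|n IHn] A hA An.
  exists [:: A]; split=> //; apply: single; lia.
have [lt|aA] := ltnP #|A| a.
  by exists [:: A]; split; [apply/single/(leq_trans (ltnW lt))/leq_addr | by []].
have [v vA dv] := deg aA.
have cAv : #|A| = (#|A :\ v|).+1 by rewrite (cardsD1 v A) vA.
have [||cs1 [[cs1b cs1P] sz1]] := IHn (A :\ v); [|lia|].
  by apply: leq_trans hA; rewrite leq_mul2r cAv leqnSn orbT.
pose B := [set y in A | ~~ r v y].
have cB : #|B| * D <= #|A| * D.-1.
  have : #|B| + #|[set y in A | r v y]| = #|A|.
    rewrite -(cardsID [set y | r v y] A) addnC; congr (_ + _); apply: eq_card => y; rewrite !inE //.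
    by rewrite andbC.
  by move: dv; case: (D) D_gt0 => // d _; nia.
have [|cs2 [[cs2b cs2P] sz2]] := IHL B.
  rewrite -(leq_pmul2r D_gt0); apply: leq_trans (_ : #|A| * D.-1 ^ L.+1 <= _).
    by rewrite expnS mulnAC mulnA leq_mul2r cB orbT.
  by rewrite -mulnA -expnSr.
exists (cs1 ++ [seq v |: C | C <- cs2]); split; last first.
  rewrite size_cat size_map; apply: leq_trans (leq_add sz1 sz2) _.
  by rewrite mulSn; lia.
split=> [C|I iI IA].
  rewrite mem_cat => /orP [/cs1b //|/mapP [C' /cs2b h ->]].
  by rewrite cardsU1; case: (_ \notin _); lia.
have [vI|vI] := boolP (v \in I); last first.
  have [|C C1 IC] := cs1P _ iI; last by exists C; rewrite // mem_cat C1.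
  by apply/subsetD1P.
have [||C C2 IC] := cs2P (I :\ v).
- apply/forall_inP=> x /setD1P [_ xI]; apply/forall_inP=> y /setD1P [_ yI].
  by have /forall_inP/(_ x xI)/forall_inP/(_ y yI) := iI.
- apply/subsetP=> x /setD1P [_ xI]; rewrite inE (subsetP IA) //=.
  by have /forall_inP/(_ v vI)/forall_inP/(_ x xI) := iI.
exists (v |: C); first by rewrite mem_cat map_f ?orbT.
by rewrite -(setD1K vI) setUS.
Qed.

(** Bernoulli's inequality (1 + 1/d)^n >= 1 + n/d at n = D = d + 1. *)
Lemma pred_exp_half : 2 * D.-1 ^ D <= D ^ D.
Proof.
case: D D_gt0 => // d _ /=.
have B n : d ^ n * (d + n) <= d.+1 ^ n * d.
  elim: n => [|n IH]; first by rewrite addn0.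
  apply: leq_trans (_ : d.+1 * (d ^ n * (d + n)) <= _).
    rewrite expnS; set u := d ^ n; nia.
  by rewrite expnS -mulnA leq_mul2l IH.
have [->|d0] := posnP d; first by [].
rewrite -(leq_pmul2r d0); apply: leq_trans (B _).
set u := d ^ d.+1; nia.
Qed.

(** Every [D] selections at least halve the available set, so [D * l] of them bring it from 2^l down
    to at most 1 <= a. *)
Lemma containers_exist l : 0 < a -> #|V| <= 2 ^ l ->
  exists cs, container_family [set: V] (a + D * l) cs /\ size cs <= #|V|.+1 ^ (D * l).
Proof.
move=> a0 Vl; apply: containers_in; rewrite cardsT.
apply: leq_trans (_ : 2 ^ l * D.-1 ^ (D * l) <= _); first by rewrite leq_mul2r Vl orbT.
rewrite !expnM -expnMn; apply: leq_trans (_ : (D ^ D) ^ l <= _); last by rewrite leq_pmull.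
by have [->|l0] := posnP l; rewrite // leq_exp2r // pred_exp_half.
Qed.
End Containers.

(** * Random pull-backs and Ramsey numbers *)

Definition K4_free (V : finType) (r : rel V) :=
  forall l1 l2 l3 l4, r l1 l2 -> r l1 l3 -> r l1 l4 -> r l2 l3 -> r l2 l4 -> r l3 l4 -> False.

Lemma bicol_irr (P V : finType) (inc : P -> V -> bool) chi : irreflexive (bicol_adj inc chi).
Proof. by move=> l; apply/existsP => -[p /cuts_neq]. Qed.

(** Four pairwise adjacent lines meet in six points; since no triangle has concurrent sides, they
    form an O'Nan configuration. *)
Lemma bicol_K4_free m (P V : finType) (inc : P -> V -> bool) chi :
  unital_like m inc -> K4_free (bicol_adj inc chi).
Proof.
case=> _ _ _ _ meet onan l1 l2 l3 l4.
move=> /existsP [a c12] /existsP [b c13] /existsP [d' c14].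
move=> /existsP [d c23] /existsP [b' c24] /existsP [a' c34].
have tri := cuts_triangle meet.
have C p l l' : cuts inc chi p l l' -> cuts inc chi p l' l by rewrite cutsC.
have I p l l' : cuts inc chi p l l' -> inc p l /\ inc p l' by case/and3P.
have U p p' l l' : inc p l -> inc p l' -> cuts inc chi p' l l' -> p = p'.
  move=> i1 i2 c; have [j1 j2] := I _ _ _ c.
  by case: (meet _ _ _ _ i1 i2 j1 j2) => // /(cuts_neq c).
have [[i1 i2] [j1 j3]] := (I _ _ _ c12, I _ _ _ c13).
have [[k1 k4] [h2 h3]] := (I _ _ _ c14, I _ _ _ c23).
have [[f2 f4] [g3 g4]] := (I _ _ _ c24, I _ _ _ c34).
apply: (onan l1 l2 l3 l4 a b d a' b' d') => //.
- exact: tri c12 c13 c23.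
- by apply/negP=> e; apply: (tri _ _ _ _ _ _ _ (C _ _ _ c12) c23 c13); apply/esym/(U _ _ _ _ h2 e (C _ _ _ c12)).
- by apply/negP=> e; apply: (tri _ _ _ _ _ _ _ c12 c14 c24); apply: (U _ _ _ _ i1 e c14).
- by apply/negP=> e; apply: (tri _ _ _ _ _ _ _ c13 c14 c34); apply: (U _ _ _ _ j1 e c14).
- by apply/negP=> e; apply: (tri _ _ _ _ _ _ _ c23 c24 c34); apply: (U _ _ _ _ h2 e c24).
Qed.

(** Union bound over the containers: a random map sends [T] into a given one with probability at
    most [(b / #|V|) ^ #|T|]. *)
Lemma card_maps_to_independent (V : finType) (r : rel V) n b cs (T : {set 'I_n}) :
  container_family r [set: V] b cs ->
  #|[set g : {ffun 'I_n -> V} | independent r [set g x | x in T]]| * #|V| ^ #|T|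
    <= size cs * b ^ #|T| * #|V| ^ n.
Proof.
case=> csb csP.
pose into C := [set g : {ffun 'I_n -> V} | [forall x in T, g x \in (C : {set V})]].
have sub : [set g : {ffun 'I_n -> V} | independent r [set g x | x in T]]
    \subset \bigcup_(C <- cs) into C.
  apply/subsetP=> g; rewrite inE => /csP [|C Ccs gC]; first exact: subsetT.
  rewrite bigcup_seq; apply/bigcupP; exists C; rewrite // inE; apply/forall_inP=> x xT.
  by apply: (subsetP gC); apply: imset_f.
apply: leq_trans (_ : (\sum_(C <- cs) #|into C|) * #|V| ^ #|T| <= _).
  rewrite leq_mul2r (leq_trans (subset_leq_card sub)) ?orbT //.
  elim: (cs) => [|C s IH]; first by rewrite !big_nil cards0.
  by rewrite !big_cons (leq_trans (leq_card_setU _ _)) // leq_add2l.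
rewrite big_distrl /= -mulnA -[size cs]count_predT -sum1_count big_distrl /= big_seq [leqRHS]big_seq.
apply: leq_sum => C Ccs; rewrite mul1n card_restricted_ffun card_ord leq_mul2r; apply/orP; right.
rewrite -prod_nat_const; apply: leq_prod => x _; exact: csb.
Qed.

(** An edge gets a colour [i] for which the map [f i] sends its ends to adjacent vertices, and the
    last colour if there is none. A K_4 in colour [i] would then map onto a K_4 of [r]. *)
Lemma blowup (V : finType) (r : rel V) k n t b cs : 0 < #|V| ->
  symmetric r -> irreflexive r -> K4_free r -> container_family r [set: V] b cs ->
  'C(n, t) * (size cs * b ^ t) ^ k < #|V| ^ (t * k) ->
  ~~ ramsey_prop k.+1 t n.
Proof.
move=> V0 rC rI rK cf hlt.
pose Q (T : {set 'I_n}) := [set g : {ffun 'I_n -> V} | independent r [set g x | x in T]].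
pose bad (T : {set 'I_n}) := [set f : {ffun 'I_k -> {ffun 'I_n -> V}} | f \in ffun_on (mem (Q T))].
(* The expected number of [t]-sets with independent image under all [k] maps is below 1. *)
have [f fP] : exists f, f \notin \bigcup_(T in [set T : {set 'I_n} | #|T| == t]) bad T.
  apply/existsP; rewrite -negb_forall; apply/negP=> /forallP h.
  have e : #|{ffun 'I_k -> {ffun 'I_n -> V}}| = (#|V| ^ n) ^ k by rewrite !card_ffun !card_ord.
  have : (#|V| ^ n) ^ k * #|V| ^ (t * k) <= 'C(n, t) * (size cs * b ^ t) ^ k * (#|V| ^ n) ^ k.
    rewrite -e; apply: leq_trans (_ : (\sum_(T in [set T : {set 'I_n} | #|T| == t]) #|bad T|) * #|V| ^ (t * k) <= _).
      rewrite leq_mul2r; apply/orP; right; apply: leq_trans (card_bigcup_le _ _).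
      by rewrite -cardsT; apply: subset_leq_card; apply/subsetP=> f _; apply: h.
    rewrite big_distrl /= e -mulnA -[n in 'C(n, _)]card_ord -card_draws -sum_nat_const.
    apply: leq_sum => T; rewrite inE => /eqP Tt.
    rewrite cardsE card_ffun_on card_ord expnM -!expnMn.
    have := card_maps_to_independent T cf; rewrite Tt => le.
    by have [->|k0] := posnP k; rewrite // leq_exp2r.
  by rewrite mulnC leq_mul2r !expn_eq0 -leqn0 leqNgt V0 /= leqNgt hlt.
pose pk (x y : 'I_n) := [pick i | r (f i x) (f i y)].
pose c : edge_col n k.+1 := [ffun z => if pk z.1 z.2 is Some i then widen_ord (leqnSn k) i else ord_max].
apply/negP=> /forallP /(_ c) /orP [].
  case/existsP=> i /andP [ik1 /existsP [S /andP [/eqP S4 /forall_inP h]]].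
  have ik : i < k := ik1.
  have {}h x y : x \in S -> y \in S -> x != y -> r (f (Ordinal ik) x) (f (Ordinal ik) y).
    wlog lt : x y / x < y => [W xS yS ne|xS yS _].
      have := ne; rewrite -val_eqE neq_ltn => /orP [lt|lt]; first exact: W.
      by rewrite rC; apply: W => //; rewrite eq_sym.
    have /forall_inP/(_ y yS) := h x xS; rewrite lt /= ffunE /pk /=.
    case: pickP => [j rj|_] /= /eqP e; first by rewrite (_ : Ordinal ik = j) //; apply: val_inj.
    by exfalso; move: ik; rewrite -e ltnn.
  have := enum_uniq S; have : size (enum S) = 4 by rewrite -cardE.
  have : {subset enum S <= S} by move=> x; rewrite mem_enum.
  case: (enum S) => [|x1 [|x2 [|x3 [|x4 []]]]] //= sub _.
  rewrite !inE !negb_or => /and4P [/and3P [n12 n13 n14] /andP [n23 n24] n34 _].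
  by apply: (rK _ _ _ _ (h x1 x2 _ _ _) (h x1 x3 _ _ _) (h x1 x4 _ _ _) (h x2 x3 _ _ _)
    (h x2 x4 _ _ _) (h x3 x4 _ _ _)) => //; apply: sub; rewrite !inE eqxx ?orbT.
case/existsP=> T /andP [Tt /forall_inP h].
have {}h x y i : x \in T -> y \in T -> ~~ r (f i x) (f i y).
  wlog lt : x y / x < y => [W xT yT|xT yT].
    have [lt|lt|/val_inj ->] := ltngtP x y; [exact: W | by rewrite rC; apply: W | by rewrite rI].
  have /forall_inP/(_ y yT) := h x xT; rewrite lt /= ffunE /pk /=.
  case: pickP => [j rj|->] //= /eqP e; have := ltn_ord j; by rewrite e ltnn.
move/negP: fP; apply; apply/bigcupP; exists T; first by rewrite inE.
rewrite inE; apply/ffun_onP => i; rewrite inE.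
by apply/forall_inP=> _ /imsetP [x xT ->]; apply/forall_inP=> _ /imsetP [y yT ->]; apply: h.
Qed.

(** * Monotonicity and existence of the Ramsey numbers *)

Lemma ramsey_prop_mono k t n n' : n <= n' -> ramsey_prop k t n -> ramsey_prop k t n'.
Proof.
move=> le /forallP h; apply/forallP=> c.
pose w := widen_ord le.
have winj : injective w by move=> x y /(congr1 val) /= /val_inj.
have lift col s : has_mono_clique ([ffun z => c (w z.1, w z.2)] : edge_col n k) col s -> has_mono_clique c col s.
  case/existsP=> S /andP [/eqP Ss /forall_inP hS]; apply/existsP; exists (w @: S).
  rewrite card_imset // Ss eqxx; apply/forall_inP=> _ /imsetP [x xS ->].
  apply/forall_inP=> _ /imsetP [y yS ->]; apply/implyP=> lt.
  by have /forall_inP/(_ y yS)/implyP/(_ lt) := hS x xS; rewrite ffunE.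
case/orP: (h [ffun z => c (w z.1, w z.2)]) => [/existsP [i /andP [ik ]]|] /lift m; last by rewrite m orbT.
by apply/orP; left; apply/existsP; exists i; rewrite ik.
Qed.

(** Induction on the sum of the targets, lowering one target inside the colour neighbourhood of a
    vertex. The subset [W] lets the hypothesis apply to that neighbourhood with the same
    colouring. *)
Lemma multicolour_ramsey (k : nat) (s : 'I_k.+1 -> nat) : exists N,
  forall (T : finType) (c : T -> T -> 'I_k.+1) (W : {set T}),
  (forall x y, c x y = c y x) -> N <= #|W| ->
  exists i (S : {set T}), [/\ S \subset W, #|S| = s i &
    forall x y, x \in S -> y \in S -> x != y -> c x y = i].
Proof.
have [n sn] := ubnP (\sum_i s i); elim: n s sn => // n IH s sn.
have [/existsP [i /eqP si]|pos] := boolP [exists i, s i == 0].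
  exists 0 => T c W cC _; exists i, set0; rewrite sub0set cards0 si; split=> // x y.
  by rewrite inE.
have {}pos i : 0 < s i by rewrite lt0n; apply: contra pos => h; apply/existsP; exists i.
pose dec i := fun j => if j == i then (s j).-1 else s j.
have decn i : \sum_j dec i j < n.
  rewrite (bigD1 i) //= /dec eqxx (eq_bigr s) => [|j /negPf ->] //.
  by move: sn; rewrite (bigD1 i) //=; have := pos i; lia.
have [N NP] : exists N : 'I_k.+1 -> nat, forall i (T : finType) (c : T -> T -> 'I_k.+1) (W : {set T}),
  (forall x y, c x y = c y x) -> N i <= #|W| ->
  exists i' (S : {set T}), [/\ S \subset W, #|S| = dec i i' &
    forall x y, x \in S -> y \in S -> x != y -> c x y = i'].
  exists (fun i => proj1_sig (constructive_indefinite_description _ (IH _ (decn i)))).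
  by move=> i; exact: (proj2_sig (constructive_indefinite_description _ (IH _ (decn i)))).
(* If every neighbourhood [nb i] were smaller than [N i], then [W], with [v] counted, would have at
   most [(\sum_i N i).+1] elements. *)
exists (\sum_i N i).+2 => T c W cC WN.
have [v vW] : exists v, v \in W by apply/card_gt0P; apply: leq_trans WN.
pose nb i := [set y in W :\ v | c v y == i].
have [i iN] : exists i, N i <= #|nb i|.
  apply/existsP; apply: contraLR WN; rewrite negb_exists => /forallP h; rewrite -leqNgt.
  rewrite (cardsD1 v W) vW add1n ltnS -sum1_card (partition_big (c v) xpredT) //=.
  apply: leq_sum => i _; rewrite sum1dep_card; have := h i; rewrite -ltnNge => /ltnW.
  by congr (_ <= _); apply: eq_card => y; rewrite !inE.
have [j [S [SN Sj hS]]] := NP i T c (nb i) cC iN.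
have SW : S \subset W by apply: subset_trans SN _; apply/subsetP=> x; rewrite !inE => /andP [/andP []].
move: Sj; rewrite /dec; case: eqP => [ji|_] Sj; last by exists j, S.
exists j, (v |: S); split.
- by rewrite subUset sub1set vW.
- rewrite cardsU1 Sj; have -> : v \notin S by apply/negP=> /(subsetP SN); rewrite !inE eqxx.
  by have := pos j; lia.
have vS x : x \in S -> c v x = j by move=> /(subsetP SN); rewrite !inE ji => /andP [_ /eqP].
move=> x y; rewrite !inE => /orP [/eqP ->|xS] /orP [/eqP ->|yS] ne.
- by rewrite eqxx in ne.
- exact: vS.
- by rewrite cC vS.
- exact: hS.
Qed.

Lemma ramsey_prop_ex k t : exists n, ramsey_prop k.+1 t n.
Proof.
have [n nP] := multicolour_ramsey (fun i : 'I_k.+1 => if i < k then 4 else t).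
exists n; apply/forallP=> c.
pose c' (x y : 'I_n) := if x < y then c (x, y) else c (y, x).
have c'C x y : c' x y = c' y x.
  by rewrite /c'; case: ltngtP => // /val_inj ->.
have [|i [S [_ Si hS]]] := nP _ c' [set: 'I_n] c'C; first by rewrite cardsT card_ord.
have hc : has_mono_clique c i (if i < k then 4 else t).
  apply/existsP; exists S; rewrite Si eqxx; apply/forall_inP=> x xS; apply/forall_inP=> y yS.
  apply/implyP=> lt; rewrite -(hS x y xS yS) ?/c' ?lt //.
  by rewrite -val_eqE neq_ltn lt.
case: ltnP hc => ik hc; apply/orP; [left|right].
  by apply/existsP; exists i; rewrite ltnS ik.
have e : nat_of_ord i = k by apply/eqP; rewrite eqn_leq ik -ltnS ltn_ord.
by rewrite e in hc.
Qed.

(** Existence rules out the default value 0 of [rk4]; monotonicity puts the minimum above every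
    failing [n]. *)
Lemma rk4_gt k t n : ~~ ramsey_prop k.+1 t n -> n < rk4 k.+1 t.
Proof.
move=> nR; rewrite /rk4; case: excluded_middle_informative => [H|[]]; last exact: ramsey_prop_ex.
case: ex_minnP => n0 h0 _; rewrite ltnNge; apply: contra nR => /ramsey_prop_mono; exact.
Qed.

(** * Choice of parameters *)

Lemma ffact_le_exp n m : n ^_ m <= n ^ m.
Proof. by elim: m => // m IH; rewrite ffactnSr expnSr leq_mul ?leq_subr. Qed.

Lemma exp_le_ffact n m : n ^ m <= (n + m) ^_ m.
Proof. by elim: m => // m IH; rewrite addnS ffactSS expnS leq_mul // -addnS leq_addr. Qed.

(** t^t <= (2t)!/t! = C(2t, t) t!, and the central binomial coefficient is a term of (1 +
    1)^(2t). *)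
Lemma exp_self_le t : t ^ t <= 4 ^ t * t`!.
Proof.
apply: leq_trans (exp_le_ffact t t) _; rewrite -bin_ffact leq_mul2r; apply/orP; right.
rewrite -[4]/(2 ^ 2) -expnM mul2n -addnn -[2 ^ _]/((1 + 1) ^ _) expnDn.
have h : t < (t + t).+1 by rewrite ltnS leq_addr.
by rewrite (bigD1 (Ordinal h)) //= !exp1n !muln1 leq_addr.
Qed.

Lemma bin_mul_le t X : 'C(t * X, t) <= (4 * X) ^ t.
Proof.
rewrite -(leq_pmul2r (fact_gt0 t)) bin_ffact; apply: leq_trans (ffact_le_exp _ _) _.
by rewrite expnMn expnMn mulnAC leq_mul2r exp_self_le orbT.
Qed.

Lemma sqr_le_exp2 m : 15 <= m -> 128 * m ^ 2 <= 2 ^ m.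
Proof.
move=> /subnK <-; elim: (m - 15) => // d IH; rewrite addSn [2 ^ _]expnS.
by apply: leq_trans (_ : 2 * (128 * (d + 15) ^ 2) <= _); [nia | rewrite leq_mul2l IH].
Qed.

Lemma small_independent_families m : 15 <= m ->
  exists (V : finType) (r : rel V), [/\ symmetric r, irreflexive r, K4_free r, 2 ^ (4 * m - 1) <= #|V| &
    exists cs, container_family r [set: V] (2 ^ (2 * m + 2)) cs /\ size cs <= 2 ^ (1280 * (2 ^ m * m ^ 3))].
Proof.
move=> m15; have mq := sqr_le_exp2 m15.
have [|P [V [inc U]]] := @unital_exists m; first by lia.
have [Pq Vge Vle line meet _] := U.
pose q := 2 ^ m; pose a := 2 * q ^ 2; pose E0 := q ^ 3 %/ (16 * m).
have q0 : 0 < q by rewrite expn_gt0.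
have Vq : #|V|.+1 <= 2 ^ (5 * m).
  apply: leq_ltn_trans Vle _; rewrite ltn_exp2l //; lia.
have PVq : (#|P| * #|V|).+1 <= 2 ^ (8 * m).
  apply: leq_ltn_trans (leq_mul Pq Vle) _; rewrite -expnD ltn_exp2l //; lia.
have [|chi hchi] := few_edges_avoidable meet (s := q.+1) (a := a) (E0 := E0) line.
  apply: leq_ltn_trans (_ : 2 ^ (5 * m * a) * 2 ^ (q ^ 3) * 2 ^ (8 * m * E0) < _).
    rewrite !leq_mul //.
    - by rewrite expnM leq_exp2r // /a; nia.
    - by rewrite leq_exp2l // /q -expnM mulnC.
    - by rewrite expnM; have [->|e0] := posnP E0; rewrite // leq_exp2r.
  (* As 20 m <= q, the exponents 10 m q^2, q^3 and 8 m E0 are at most q^3/2, q^3 and q^3/2, against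
     2 q^2 (q + 1) on the right. *)
  rewrite -!expnD ltn_exp2l //.
  have : E0 * (16 * m) <= q ^ 3 by apply: leq_trunc_div.
  have : 20 * m <= q by nia.
  rewrite /a; move: q0; move: (q) => Q; move: (E0) => e; nia.
exists V, (bicol_adj inc chi); split.
- exact: bicol_adjC.
- exact: bicol_irr.
- exact: bicol_K4_free U.
- exact: Vge.
(* Chosen so that (E0 + 1) D > 4 q^4 = a^2. With [l = 4 * m] the containers have size at most 2 q^2
   + 256 m^2 q <= 4 q^2. *)
pose D := 64 * m * q.
have a2 : 2 <= a by rewrite /a; nia.
have aED : a ^ 2 <= E0.+1 * D.
  have : q ^ 3 < E0.+1 * (16 * m) by rewrite ltn_ceil //; lia.
  rewrite /a /D; move: (E0.+1) => e; nia.
have deg := max_degree (bicol_irr inc chi) a2 (ltn0Sn E0) aED hchi.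
have D0 : 0 < D by rewrite /D; nia.
have [|cs [csf szcs]] := containers_exist D0 deg _ Vle; first by lia.
exists cs; split.
  case: csf => h1 h2; split=> // C /h1 le; apply: leq_trans le _.
  rewrite (_ : 2 ^ (2 * m + 2) = 4 * q ^ 2); last by rewrite expnD mulnC /q -expnM (mulnC m).
  rewrite /a /D; move: mq; rewrite -/q; nia.
apply: leq_trans szcs _; apply: leq_trans (_ : (2 ^ (5 * m)) ^ (D * (4 * m)) <= _).
  by rewrite leq_exp2r //; nia.
rewrite -expnM leq_exp2l // /D -/q; nia.
Qed.

(* 1286 - 1280 absorbs the factors 4 lost in the binomial coefficient, in the container
   size and in [#|V|]. *)
Lemma rk4_lower k m t : 0 < k -> 643 <= m -> 2 ^ m * m ^ 3 <= t ->
  t * 2 ^ ((2 * m - 1286) * k) < rk4 k.+1 t.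
Proof.
move=> k0 m643 mt; apply: rk4_gt.
have [|V [r [rC rI rK Vge [cs [cf szcs]]]]] := @small_independent_families m; first by lia.
have t0 : 0 < t by apply: leq_trans mt; rewrite muln_gt0 !expn_gt0 /=; lia.
apply: blowup rC rI rK cf _; first by apply: leq_trans Vge; rewrite expn_gt0.
set X := 2 ^ _.
apply: leq_ltn_trans (leq_mul (bin_mul_le t X) (leqnn _)) _.
apply: leq_ltn_trans (_ : (2 ^ (2 + (2 * m - 1286) * k)) ^ t * (2 ^ (1280 * t) * (2 ^ (2 * m + 2)) ^ t) ^ k < _).
  rewrite leq_mul //; first by rewrite expnD.
  rewrite leq_exp2r // leq_mul2r; apply/orP; right.
  by apply: leq_trans szcs _; rewrite leq_exp2l // leq_mul2l mt.
apply: leq_trans (_ : (2 ^ (4 * m - 1)) ^ (t * k) <= _); last by rewrite leq_exp2r // muln_gt0 t0.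
rewrite -!expnM -expnD -expnM -expnD ltn_exp2l //.
(* After division by [t] the claim is 2 + (4m - 4)k < (4m - 1)k. *)
rewrite -mulnDl -(mulnAC _ k) -mulnDl (mulnC t k) mulnA ltn_pmul2r // -addnA -mulnDl.
rewrite (_ : 4 * m - 1 = 2 * m - 1286 + (1280 + (2 * m + 2)) + 3); last by lia.
by rewrite [X in _ < X]mulnDl [2 + _]addnC ltn_add2l; lia.
Qed.

(** The largest admissible [m], which exists because 2^m m^3 <= t forces m <= t. *)
Lemma choose_exponent m0 t : 2 ^ m0 * m0 ^ 3 <= t -> exists m,
  [/\ m0 <= m, 2 ^ m * m ^ 3 <= t & t < 2 ^ m.+1 * m.+1 ^ 3].
Proof.
move=> h0; pose p m := (m0 <= m) && (2 ^ m * m ^ 3 <= t).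
have ub m : p m -> m <= t.
  case/andP=> _; apply: leq_trans; have [->//|m1] := posnP m.
  by apply: leq_trans (ltnW (ltn_expl m (ltnSn 1))) _; rewrite leq_pmulr // expn_gt0 m1.
have ex : exists m, p m by exists m0; rewrite /p leqnn.
case: (ex_maxnP ex ub) => m /andP [m0m mt] mx; exists m; split=> //.
rewrite ltnNge; apply/negP=> h; have := mx m.+1; rewrite /p h (leq_trans m0m) // ltnn.
by move/(_ isT).
Qed.

(* The bound over the reals, with logarithms *)
From Stdlib Require Import Reals Lra.
From mathcomp Require Import all_boot.
Open Scope R_scope.

Lemma INR_expn (a b : nat) : INR (a ^ b)%N = INR a ^ b.
Proof. by elim: b => // b IH; rewrite expnS mult_INR IH. Qed.

Lemma INR_exp2 (b : nat) : INR (2 ^ b)%N = 2 ^ b.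
Proof. by rewrite INR_expn (_ : INR 2 = 2) //=; lra. Qed.

Lemma INR_leq (a b : nat) : (a <= b)%N -> INR a <= INR b.
Proof. by move/leP; apply: le_INR. Qed.

Lemma ln_ge_half_exponent (m t : nat) : (2 ^ m <= t)%N -> INR m / 2 <= ln (INR t).
Proof.
move=> /INR_leq; rewrite INR_exp2 => h.
have p : 0 < 2 ^ m by apply: pow_lt; lra.
apply: Rle_trans (_ : ln (2 ^ m) <= _); last first.
  by case: h => [h|->]; [left; apply: ln_increasing | right].
rewrite ln_pow; last by lra.
have := pos_INR m; have := ln_lt_2; nra.
Qed.

(** From t <= 2^(m+1) (2m)^3 and ln t >= m/2 the powers of [m] cancel; the 14 is 2 + 6 + 6. *)
Lemma sqr_over_log (m t : nat) : (0 < m)%N -> (2 ^ m <= t)%N -> (t < 2 ^ m.+1 * m.+1 ^ 3)%N ->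
  INR t ^ 2 / ln (INR t) ^ 6 <= 2 ^ (2 * m + 14).
Proof.
move=> m0 mt tm; have lnt := ln_ge_half_exponent mt.
have m1 : 1 <= INR m by apply: (INR_leq (a := 1)).
have lm : 0 < INR m / 2 by lra.
have l6 : (INR m / 2) ^ 6 <= ln (INR t) ^ 6 by apply: pow_incr; lra.
have p6 : 0 < (INR m / 2) ^ 6 by apply: pow_lt.
have tu : INR t <= 2 * 2 ^ m * (2 * INR m) ^ 3.
  apply: Rle_trans (INR_leq (ltnW tm)) _; rewrite mult_INR INR_exp2 INR_expn S_INR.
  apply: Rmult_le_compat; [apply: pow_le; lra | apply: pow_le; lra | by rewrite /=; lra|].
  by apply: pow_incr; have := pos_INR m; lra.
have p2 : 0 < 2 ^ m by apply: pow_lt; lra.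
have t2 : INR t ^ 2 <= (2 * 2 ^ m * (2 * INR m) ^ 3) ^ 2.
  by apply: pow_incr; split => //; apply: pos_INR.
have q6 : 0 < ln (INR t) ^ 6 by apply: Rlt_le_trans p6 l6.
apply: (Rmult_le_reg_r (ln (INR t) ^ 6)) => //.
rewrite /Rdiv Rmult_assoc Rinv_l; last exact: Rgt_not_eq.
rewrite Rmult_1_r; apply: Rle_trans t2 _.
apply: Rle_trans (_ : 2 ^ (2 * m + 14)%N * (INR m / 2) ^ 6 <= _).
  right; rewrite mulnC -plusE -multE pow_add pow_mult; field.
apply: Rmult_le_compat_l l6; apply: pow_le; lra.
Qed.

Theorem theorem2 :
  forall k : nat, (3 <= k)%N ->
  exists gamma : R, 0 < gamma /\
  exists t0 : nat, forall t : nat, (t0 <= t)%N ->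
    gamma * (INR t ^ (2 * k - 1)%N) / (ln (INR t) ^ (6 * (k - 1))%N)
      <= INR (rk4 k t).
Proof.
case=> [|k] // k2; have k0 : (0 < k)%N by lia.
(* 1300 = 1286 + 14 joins the losses of [rk4_lower] and [sqr_over_log]. *)
pose c : R := 2 ^ 1300; have c0 : 0 < c by apply: pow_lt; lra.
exists ((/ c) ^ k); split; first by apply/pow_lt/Rinv_0_lt_compat.
exists (2 ^ 643 * 643 ^ 3)%N => t /choose_exponent [m [m643 mt tm]].
have m0 : (0 < m)%N by lia.
have mt' : (2 ^ m <= t)%N by apply: leq_trans mt; rewrite leq_pmulr // expn_gt0 m0.
apply: Rle_trans (INR_leq (ltnW (rk4_lower k0 m643 mt))).
rewrite [X in _ <= X]mult_INR INR_exp2.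
have -> : (2 * k.+1 - 1 = 1 + 2 * k)%N by lia.
have -> : (6 * (k.+1 - 1) = 6 * k)%N by lia.
rewrite -plusE -!multE pow_add !pow_mult pow_1.
have S := sqr_over_log m0 mt' tm.
have lnp : 0 < ln (INR t).
  apply: Rlt_le_trans (ln_ge_half_exponent mt'); have := lt_0_INR m (ltP m0); lra.
have l6 : 0 < ln (INR t) ^ 6 by apply: pow_lt.
(* Apart from one factor [t], both sides are [k]-th powers, so it suffices to compare the bases. *)
have powE a u v w : a ^ k * (u * v ^ k) / w ^ k = u * (a * (v / w)) ^ k.
  by rewrite /Rdiv !Rpow_mult_distr pow_inv; ring.
rewrite powE.
apply: Rmult_le_compat_l; first exact: pos_INR.
apply: pow_incr; split.
  apply: Rmult_le_pos; first by left; apply: Rinv_0_lt_compat.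
  apply: Rmult_le_pos; first by apply/pow_le/pos_INR.
  by left; apply: Rinv_0_lt_compat.
apply: (Rmult_le_reg_l c) => //.
rewrite -Rmult_assoc Rinv_r; last by lra.
rewrite Rmult_1_l; apply: Rle_trans S _; right.
rewrite (_ : (2 * m + 14 = 1300 + (2 * m - 1286))%N); last by lia.
by rewrite -plusE pow_add.
Qed.
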